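(* Let $p\in(0,1)$ and let $\overline{W}_p=(\overline{W}_{i,j})_{i,j\in\mathbb{Z}}$ be the transition operator of the simple random walk on $\mathbb{Z}$: for all $i\in\mathbb{Z}$, $\overline{W}_{i,i-1}=1-p$, $\overline{W}_{i,i+1}=p$, and $\overline{W}_{i,j}=0$ if $j\notin\{i-1,i+1\}$. (a) If $p\neq 1/2$, then for $X=c_0(\mathbb{Z})$ or $X=l^q(\mathbb{Z})$ with $q\ge1$ real, the operator $\lambda\overline{W}_p$ is not hypercyclic on $X$ for all $\lambda\in\mathbb{C}$ with $|\lambda|\ge\frac{1}{|1-2p|}$. (b) If $p=1/2$, then $\overline{W}_p$ is not supercyclic on $l^1(\mathbb{Z})$.
   Context: $c_0(\mathbb{Z})$ is the space of complex families $(x_i)_{i\in\mathbb{Z}}$ with $x_i\to0$ as $|i|\to\infty$, with the supremum norm; $l^q(\mathbb{Z})$ is the space of complex families with $\|x\|_q=(\sum_{i\in\mathbb{Z}}|x_i|^q)^{1/q}<\infty$. A matrix acts by $(\overline{W}x)_i=\sum_j\overline{W}_{i,j}x_j$. A bounded linear operator $T$ on a separable complex Banach space $X$ is hypercyclic if there is $x\in X$ whose orbit $\{T^nx:n\in\mathbb{N}\}$ is dense in $X$, and supercyclic if there is $x\in X$ such that $\{\lambda T^n x : n\in\mathbb{N},\ \lambda\in\mathbb{C}\}$ is dense in $X$. *)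

(* Defs.v *)
From HB Require Import structures.
From mathcomp Require Import all_boot all_order all_algebra.
From mathcomp Require Import all_classical all_reals all_analysis.
From mathcomp Require Import complex ring zify.

Set Implicit Arguments.
Unset Strict Implicit.
Unset Printing Implicit Defensive.

Import Order.TTheory GRing.Theory Num.Theory.
Import numFieldNormedType.Exports.
Import Normc.

Local Open Scope classical_set_scope.
Local Open Scope ring_scope.
Local Open Scope complex_scope.

Section BoundedOperators.
Context {K : numFieldType} {X : normedModType K}.

Record bounded_operator := BoundedOperator {
  operator :> {linear X -> X};
  operator_bounded : exists M : K, forall x, `|operator x| <= M * `|x| }.

Lemma scale_operator_bounded (a : K) (T : bounded_operator) :
  exists M : K, forall x, `|(a \*: (T : {linear X -> X})) x| <= M * `|x|.
Proof.
have [M TM] := operator_bounded T; exists (`|a| * M) => x.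
by rewrite /= normrZ -mulrA ler_wpM2l.
Qed.

Definition scale_operator (a : K) (T : bounded_operator) : bounded_operator :=
  BoundedOperator (scale_operator_bounded a T).

Definition hypercyclic (T : bounded_operator) : Prop :=
  exists x : X, dense [set iter n T x | n in [set: nat]].

Definition supercyclic (T : bounded_operator) : Prop :=
  exists x : X, dense [set a *: iter n T x | a in [set: K] & n in [set: nat]].

End BoundedOperators.
Arguments bounded_operator {K} X.


(* normc : R[i] -> R is the real-valued modulus; the canonical norm of R[i]
   takes its values in R[i]. *)
Lemma normcE0 (R : realType) (z : R[i]) : `|z| = (normc z)%:C.
Proof. by case: z. Qed.

Lemma normcD_le (R : realType) (z w : R[i]) : normc (z + w) <= normc z + normc w.
Proof. exact: (@le_normcD R). Qed.

Lemma normc_ge0 (R : realType) (z : R[i]) : 0 <= normc z.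
Proof. by rewrite -ler0c -normcE0. Qed.


Section SequenceSpaces.
Variable R : realType.
Notation C := R[i].
Notation seqZ := (int -> R[i]^o).
Implicit Types (x y : seqZ) (a : C).

Definition shift (k : int) x : seqZ := fun i => x (i + k).


(* The finitely supported sum is 0 when its support is infinite, so this is the
   action of a matrix whose rows have finite support, such as Wbar below. *)
Definition matrix_action (A : int -> int -> C) x : seqZ :=
  fun i => \sum_(j \in [set: int]) A i j * x j.

Definition Wbar (p : R) (i j : int) : C :=
  if j == i - 1 then (1 - p)%:C else if j == i + 1 then p%:C else 0.

Lemma Wbar_actionE p x : matrix_action (Wbar p) x =
  (1 - p)%:C *: shift (- 1) x + p%:C *: shift 1 x.
Proof.
apply/funext => i; rewrite /matrix_action.
have ne : i + 1 != i - 1 by rewrite (inj_eq (addrI i)).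
rewrite -(@fsbig_widen _ _ _ _ ([set i - 1] `|` [set i + 1])) //; last first.
  move=> j [_ /= /not_orP[/eqP/negPf j1 /eqP/negPf j2]].
  by rewrite /Wbar j1 j2 mul0r.
rewrite fsbigU0 //; last by move=> j [/= ->] /esym/eqP; rewrite (negPf ne).
by rewrite !fsbig_set1 /Wbar eqxx (negPf ne) eqxx.
Qed.

(* A shift-invariant norm N on a subspace P of C^Z. Both c_0(Z) and l^q(Z) are
   obtained as the normed space seq_space below, on which every Wbar p acts
   boundedly. *)
Record shift_invariant_norm (P : set seqZ) (N : seqZ -> R) : Prop := {
  sin_P0 : P 0;
  sin_PD : forall x y, P x -> P y -> P (x + y);
  sin_PZ : forall a x, P x -> P (a *: x);
  sin_Pshift : forall k x, P x -> P (shift k x);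
  sin_ND : forall x y, P x -> P y -> N (x + y) <= N x + N y;
  sin_NZ : forall a x, P x -> N (a *: x) = normc a * N x;
  sin_N0 : forall x, P x -> N x = 0 -> x = 0;
  sin_Nshift : forall k x, P x -> N (shift k x) = N x }.

Section NormedSpace.
Variables (P : set seqZ) (N : seqZ -> R) (H : shift_invariant_norm P N).

Definition seq_pred of shift_invariant_norm P N : {pred seqZ} := mem P.

Lemma seq_pred_submod : submod_closed (seq_pred H).
Proof.
split=> [|a x y]; first exact/mem_set/(sin_P0 H).
move=> /set_mem Px /set_mem Py; apply/mem_set.
by apply: (sin_PD H) => //; exact: (sin_PZ H).
Qed.

HB.instance Definition _ :=
  GRing.isSubmodClosed.Build C seqZ (seq_pred H) seq_pred_submod.

Record seq_space := SeqSpace {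
  seq_val :> seqZ;
  seq_valP : seq_val \in seq_pred H }.

HB.instance Definition _ := [isSub for seq_val].
HB.instance Definition _ := [Choice of seq_space by <:].
HB.instance Definition _ := [SubChoice_isSubLmodule of seq_space by <:].

Lemma seq_mem (x : seq_space) : P x.
Proof. exact/set_mem/seq_valP. Qed.

Definition seq_norm (x : seq_space) : C := (N x)%:C.

Lemma seq_normD (x y : seq_space) : seq_norm (x + y) <= seq_norm x + seq_norm y.
Proof. by rewrite -rmorphD lecR; apply: (sin_ND H); exact: seq_mem. Qed.

Lemma seq_normZ a (x : seq_space) : seq_norm (a *: x) = `|a| * seq_norm x.
Proof. by rewrite normcE0 -rmorphM; congr _%:C; apply: (sin_NZ H); exact: seq_mem. Qed.

Lemma seq_norm0 (x : seq_space) : seq_norm x = 0 -> x = 0.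
Proof.
by case=> Nx0; apply/val_inj/(sin_N0 H) => //; exact: seq_mem.
Qed.

HB.instance Definition _ :=
  Lmodule_isNormed.Build C seq_space seq_normD seq_normZ seq_norm0.

Lemma seq_space_normE (x : seq_space) : `|x| = (N x)%:C.
Proof. by []. Qed.


Lemma Wbar_mem p x : P x -> P (matrix_action (Wbar p) x).
Proof.
move=> Px; rewrite Wbar_actionE.
by apply: (sin_PD H); apply: (sin_PZ H); exact: (sin_Pshift H).
Qed.

Definition Wbar_fun (p : R) (x : seq_space) : seq_space :=
  SeqSpace (mem_set (Wbar_mem p (seq_mem x)) : _ \in seq_pred H).

Lemma Wbar_fun_linear p : linear (Wbar_fun p).
Proof.
move=> a x y; apply/val_inj; rewrite /= !Wbar_actionE; apply/funext => i.
rewrite /shift !fctE /=.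
rewrite !scalerDr !scalerA ![a * _]mulrC addrACA.
by [].
Qed.

HB.instance Definition _ p :=
  GRing.isLinear.Build C seq_space seq_space _ (Wbar_fun p) (Wbar_fun_linear p).

Lemma Wbar_fun_bounded p :
  exists M : C, forall x : seq_space, `|Wbar_fun p x| <= M * `|x|.
Proof.
exists (normc (1 - p)%:C + normc p%:C)%:C => x.
rewrite !seq_space_normE -rmorphM lecR /= Wbar_actionE.
have Px := seq_mem x.
have Pa := sin_PZ H (1 - p)%:C (sin_Pshift H (- 1) Px).
have Pb := sin_PZ H p%:C (sin_Pshift H 1 Px).
apply: (le_trans (sin_ND H Pa Pb)).
rewrite !(sin_NZ H); try exact: (sin_Pshift H).
by rewrite !(sin_Nshift H) // mulrDl.
Qed.

Definition Wbar_operator (p : R) : bounded_operator seq_space :=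
  BoundedOperator (Wbar_fun_bounded p).

End NormedSpace.
End SequenceSpaces.

Section C0.
Variable R : realType.
Notation seqZ := (int -> R[i]^o).
Implicit Types (x y : seqZ) (a : R[i]).

Definition c0 : set seqZ := [set x | forall e : R, 0 < e ->
  exists N : nat, forall i : int, (N <= `|i|)%N -> normc (x i) < e].

Definition sup_norm x : R := sup [set normc (x i) | i in [set: int]].

Lemma c0_bounded x : c0 x -> has_ubound [set normc (x i) | i in [set: int]].
Proof.
move=> /(_ 1 ltr01)[N xN].
pose M := \sum_(k < N) (normc (x k%:Z) + normc (x (- k%:Z))).
have M0 (Q : pred 'I_N) :
    0 <= \sum_(k < N | Q k) (normc (x k%:Z) + normc (x (- k%:Z))).
  by apply: sumr_ge0 => k _; apply: addr_ge0; exact: normc_ge0.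
exists (M + 1) => _ [i _ <-].
have [Ni|iN] := leqP N `|i|%N.
  by apply: (le_trans (ltW (xN _ Ni))); rewrite lerDr; exact: M0.
apply: ler_wpDr => //; rewrite /M (bigD1 (Ordinal iN)) //=.
apply: ler_wpDr; first exact: M0.
have [{1}->|{1}->] : i = `|i|%N%:Z \/ i = - `|i|%N%:Z.
- by case: i {iN} => n; [left|right].
- by rewrite lerDl; exact: normc_ge0.
- by rewrite lerDr; exact: normc_ge0.
Qed.

Lemma sup_norm_ub x i : c0 x -> normc (x i) <= sup_norm x.
Proof. by move=> /c0_bounded xb; apply: ub_le_sup => //; exists i. Qed.

Lemma sup_norm_le x (M : R) : (forall i, normc (x i) <= M) -> sup_norm x <= M.
Proof.
move=> xM; apply: ge_sup; first by exists (normc (x 0)); exists 0.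
by move=> _ [i _ <-].
Qed.

Lemma c0_add x y : c0 x -> c0 y -> c0 (x + y).
Proof.
move=> Px Py e e0; have e20 : 0 < e / 2 by rewrite divr_gt0.
have [N xN] := Px _ e20; have [M yM] := Py _ e20.
exists (maxn N M) => i; rewrite geq_max => /andP[/xN xi /yM yi].
by apply: (le_lt_trans (normcD_le _ _)); rewrite (splitr e) ltrD.
Qed.

Lemma c0_scale a x : c0 x -> c0 (a *: x).
Proof.
move=> Px e e0.
have a0 := normc_ge0 a; have a1 : 0 < normc a + 1 by rewrite ltr_wpDl.
have [N xN] := Px (e / (normc a + 1)) (divr_gt0 e0 a1).
exists N => i /xN; rewrite ltr_pdivlMr // => xi.
rewrite normcM mulrC; apply: le_lt_trans xi.
by rewrite ler_wpM2l ?normc_ge0 // lerDl.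
Qed.

Lemma c0_shift k x : c0 x -> c0 (shift k x).
Proof.
move=> Px e e0; have [N xN] := Px e e0.
exists (N + `|k|)%N => i Ni; apply: xN; lia.
Qed.

Lemma c0_shift_invariant_norm : shift_invariant_norm c0 sup_norm.
Proof.
have shift_le k x : c0 x -> sup_norm (shift k x) <= sup_norm x.
  by move=> Px; apply: sup_norm_le => i; exact: (sup_norm_ub (i + k) Px).
have scale_le a x : c0 x -> sup_norm (a *: x) <= normc a * sup_norm x.
  move=> Px; apply: sup_norm_le => i.
  by rewrite normcM ler_wpM2l ?normc_ge0 //; exact: sup_norm_ub.
have ge0 x : c0 x -> 0 <= sup_norm x.
  by move=> Px; apply: le_trans (sup_norm_ub 0 Px); exact: normc_ge0.
split.
- by move=> e e0; exists 0%N => i _; rewrite (_ : normc _ = 0) //; exact: normc0.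
- exact: c0_add.
- exact: c0_scale.
- exact: c0_shift.
- move=> x y Px Py; apply: sup_norm_le => i.
  by apply: (le_trans (normcD_le _ _)); rewrite lerD //; exact: sup_norm_ub.
- move=> a x Px; apply/eqP; rewrite eq_le scale_le //=.
  have [->|a0] := eqVneq a 0.
    by rewrite normc0 mul0r; apply: ge0; exact: c0_scale.
  have na0 : 0 < normc a.
    by rewrite lt_neqAle normc_ge0 andbT eq_sym; apply: contra a0 => /eqP/eq0_normc ->.
  rewrite -ler_pdivlMl // -normcV -{1}[x]scale1r -(mulVf a0) -scalerA.
  by apply: scale_le; exact: c0_scale.
- move=> x Px x0; apply/funext => i; apply: eq0_normc; apply/eqP.
  by rewrite eq_le normc_ge0 andbT -x0 sup_norm_ub.
- move=> k x Px; apply/eqP; rewrite eq_le shift_le //=.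
  have {1}-> : x = shift (- k) (shift k x).
    by apply/funext => i; rewrite /shift addrNK.
  by apply: shift_le; exact: c0_shift.
Qed.

Definition c0Z : Type := seq_space c0_shift_invariant_norm.

Definition Wbar_c0 (p : R) : bounded_operator c0Z :=
  Wbar_operator c0_shift_invariant_norm p.

End C0.

Section Lq.
Variables (R : realType) (q : R).
Notation seqZ := (int -> R[i]^o).
Implicit Types (x y : seqZ) (a : R[i]).

Definition lq_sum x : \bar R :=
  (\esum_(i in [set: int]) (normc (x i) `^ q)%:E)%E.

Definition lq : set seqZ := [set x | (lq_sum x < +oo)%E].

Definition lq_norm x : R := fine (lq_sum x) `^ q^-1.

Lemma lq_sum_ge0 x : (0 <= lq_sum x)%E.
Proof. by apply: esum_ge0 => i _; rewrite lee_fin powR_ge0. Qed.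

Lemma lq_norm_ge0 x : 0 <= lq_norm x.
Proof. exact: powR_ge0. Qed.

Lemma lq_sum_shift k x : lq_sum (shift k x) = lq_sum x.
Proof.
rewrite /lq_sum -(@reindex_esum R _ _ setT setT (fun i : int => i + k)
  (fun i => (normc (x i) `^ q)%:E)) //.
split=> //; first by move=> i j _ _ /addIr.
by move=> j _; exists (j - k) => //=; rewrite subrK.
Qed.

Hypothesis q1 : 1 <= q.
Let q_gt0 : 0 < q. Proof. exact: lt_le_trans q1. Qed.
Let q_neq0 : q != 0. Proof. by rewrite gt_eqF. Qed.

Lemma lq_sumE x : lq x -> lq_sum x = (lq_norm x `^ q)%:E.
Proof.
move=> Px; have x0 := lq_sum_ge0 x.
rewrite /lq_norm -powRrM mulVf // powRr1 ?fine_ge0 // fineK //.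
by rewrite ge0_fin_numE.
Qed.

Lemma lq_norm_le x (M : R) : 0 <= M -> (lq_sum x <= (M `^ q)%:E)%E ->
  lq x /\ lq_norm x <= M.
Proof.
move=> M0 xM; have Px : lq x by apply: le_lt_trans xM _; rewrite ltry.
split=> //; move: xM; rewrite lq_sumE // lee_fin.
apply: contraTT; rewrite -!ltNge => Mx.
by apply: gt0_ltr_powR => //; rewrite nnegrE // lq_norm_ge0.
Qed.

Lemma lq_ptwise x i : lq x -> normc (x i) <= lq_norm x.
Proof.
move=> Px; have : (((normc (x i)) `^ q)%:E <= lq_sum x)%E.
  apply: esum_ge; exists [set i]; first by split.
  by rewrite fsbig_set1.
rewrite lq_sumE // lee_fin; apply: contraTT; rewrite -!ltNge => Mx.
by apply: gt0_ltr_powR => //; rewrite nnegrE ?lq_norm_ge0 ?normc_ge0.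
Qed.

Lemma esumZ_le (c : R) (f : int -> R) : 0 <= c -> (forall i, 0 <= f i) ->
  (\esum_(i in [set: int]) (c * f i)%:E <=
   c%:E * \esum_(i in [set: int]) (f i)%:E)%E.
Proof.
move=> c0 f0; apply: ge_ereal_sup => _ [X [Xfin _] <-].
under eq_fsbigr do rewrite EFinM.
rewrite -ge0_mule_fsumr; last by move=> i; rewrite lee_fin.
by apply: lee_wpmul2l; rewrite ?lee_fin //; apply: ereal_sup_ubound; exists X.
Qed.

Lemma lq_scale_le a x : lq x ->
  lq (a *: x) /\ lq_norm (a *: x) <= normc a * lq_norm x.
Proof.
move=> Px; apply: lq_norm_le; first by rewrite mulr_ge0 ?normc_ge0 ?lq_norm_ge0.
rewrite powRM ?normc_ge0 ?lq_norm_ge0 // EFinM -lq_sumE //.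
apply: le_trans (esumZ_le (powR_ge0 _ _) (fun i => powR_ge0 (normc (x i)) q)).
apply: le_esum => i _.
by rewrite lee_fin -powRM ?normc_ge0 //= normcM.
Qed.

Lemma lq_norm_eq0 x : lq x -> lq_norm x = 0 -> x = 0.
Proof.
move=> Px x0; apply/funext => i; apply: eq0_normc; apply/eqP.
by rewrite eq_le normc_ge0 andbT -x0 lq_ptwise.
Qed.

Lemma lq_norm0 : lq 0 /\ lq_norm 0 <= 0.
Proof.
apply: lq_norm_le => //; rewrite powR0 // /lq_sum esum1 // => i _.
by rewrite (_ : normc _ = 0) ?powR0 //; exact: normc0.
Qed.

Lemma lq_minkowski x y : lq x -> lq y ->
  lq (x + y) /\ lq_norm (x + y) <= lq_norm x + lq_norm y.
Proof.
move=> Px Py.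
have [x0|x0] := eqVneq (lq_norm x) 0.
  by rewrite (lq_norm_eq0 Px x0) add0r lerDr lq_norm_ge0.
have [y0|y0] := eqVneq (lq_norm y) 0.
  by rewrite (lq_norm_eq0 Py y0) addr0 lerDl lq_norm_ge0.
have {x0}a0 : 0 < lq_norm x by rewrite lt_neqAle eq_sym x0 lq_norm_ge0.
have {y0}b0 : 0 < lq_norm y by rewrite lt_neqAle eq_sym y0 lq_norm_ge0.
move: (lq_norm x) (lq_norm y) a0 b0 (lq_sumE Px) (lq_sumE Py).
move=> a b a0 b0 xE yE.
have ab0 : 0 < a + b by exact: addr_gt0.
apply: lq_norm_le; first exact: ltW.
pose t := a / (a + b).
have t01 : 0 <= t <= 1.
  apply/andP; split; first by rewrite /t divr_ge0 // ltW.
  by rewrite /t ler_pdivrMr // mul1r lerDl ltW.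
have tE : 1 - t = b / (a + b).
  by rewrite /t -{1}(divff (lt0r_neq0 ab0)) -mulrBl addrC addKr.
pose c := (a + b) `^ q * t / a `^ q; pose d := (a + b) `^ q * (1 - t) / b `^ q.
have t1_ge0 : 0 <= 1 - t by case/andP: t01 => _; rewrite subr_ge0.
have c_ge0 : 0 <= c.
  rewrite divr_ge0 ?powR_ge0 // mulr_ge0 ?powR_ge0 //; by case/andP: t01.
have d_ge0 : 0 <= d by rewrite divr_ge0 ?powR_ge0 // mulr_ge0 ?powR_ge0.
have key i : normc ((x + y) i) `^ q <=
    c * normc (x i) `^ q + d * normc (y i) `^ q.
  have nx := normc_ge0 (x i); have ny := normc_ge0 (y i).
  have xa : 0 <= normc (x i) / a by rewrite divr_ge0 // ltW.
  have yb : 0 <= normc (y i) / b by rewrite divr_ge0 // ltW.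
  apply: (@le_trans _ _ ((normc (x i) + normc (y i)) `^ q)).
    apply: ge0_ler_powR; rewrite ?nnegrE ?normc_ge0 ?addr_ge0 ?(ltW q_gt0) //.
    exact: normcD_le.
  have -> : normc (x i) + normc (y i) =
      (a + b) * (t * (normc (x i) / a) + (1 - t) * (normc (y i) / b)).
    rewrite tE /t; field.
    by rewrite !lt0r_neq0.
  rewrite powRM ?(ltW ab0) //; last first.
    by case/andP: t01 => t0 _; apply: addr_ge0; exact: mulr_ge0.
  have := @convex_powR R q q1 (Itv01 (proj1 (andP t01)) (proj2 (andP t01)))
    (normc (x i) / a) (normc (y i) / b).
  rewrite !inE /= !in_itv /= !andbT => /(_ xa yb).
  rewrite !convRE /= => cvx.
  apply: (le_trans (ler_wpM2l (powR_ge0 _ _) cvx)).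
  rewrite !powRM ?invr_ge0 ?(ltW a0) ?(ltW b0) //.
  have powRV (u : R) : 0 < u -> u^-1 `^ q = (u `^ q)^-1.
    by move=> /ltW u0; rewrite -powR_inv1 // -powRrM mulN1r powRN.
  rewrite !powRV // /c /d le_eqVlt; apply/orP; left; apply/eqP.
  rewrite /unstable.onem; ring.
have S1 := esumZ_le c_ge0 (fun i => powR_ge0 (normc (x i)) q).
have S2 := esumZ_le d_ge0 (fun i => powR_ge0 (normc (y i)) q).
apply: (@le_trans _ _ (c%:E * lq_sum x + d%:E * lq_sum y)%E).
  apply: le_trans (leeD S1 S2).
  rewrite -esumD; last 2 first.
  - by move=> i _; rewrite lee_fin mulr_ge0 ?powR_ge0.
  - by move=> i _; rewrite lee_fin mulr_ge0 ?powR_ge0.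
  by apply: le_esum => i _; rewrite -EFinD lee_fin.
rewrite xE yE -!EFinM -EFinD lee_fin /c /d !divfK ?lt0r_neq0 ?powR_gt0 //.
by rewrite -mulrDr subrKC mulr1.
Qed.

Lemma lq_shift_invariant_norm : shift_invariant_norm lq lq_norm.
Proof.
split.
- by case: lq_norm0.
- by move=> x y Px Py; case: (lq_minkowski Px Py).
- by move=> a x Px; case: (lq_scale_le a Px).
- by move=> k x; rewrite /lq /= lq_sum_shift.
- by move=> x y Px Py; case: (lq_minkowski Px Py).
- move=> a x Px; have [Pax le_ax] := lq_scale_le a Px.
  apply/eqP; rewrite eq_le le_ax /=.
  have [->|a0] := eqVneq a 0; first by rewrite normc0 mul0r lq_norm_ge0.
  have na0 : 0 < normc a.
    rewrite lt_neqAle normc_ge0 andbT eq_sym.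
    by apply: contra a0 => /eqP/eq0_normc ->.
  have [_] := lq_scale_le a^-1 Pax.
  by rewrite scalerA mulVf // scale1r normcV ler_pdivlMl.
- exact: lq_norm_eq0.
- by move=> k x _; rewrite /lq_norm lq_sum_shift.
Qed.

Definition lqZ : Type := seq_space lq_shift_invariant_norm.

Definition Wbar_lq (p : R) : bounded_operator lqZ :=
  Wbar_operator lq_shift_invariant_norm p.

End Lq.

(* Main.v *)
Require Import Defs.
From HB Require Import structures.
From mathcomp Require Import all_boot all_order all_algebra.
From mathcomp Require Import all_classical all_reals all_analysis.
From mathcomp Require Import complex.
From mathcomp Require Import ring lra zify.

(** If [p != 1/2], the triangle inequality gives
    [|1 - 2 p| * ||x|| <= ||Wbar_p x||] for every shift-invariant norm, so
    [lambda Wbar_p] does not decrease norms and a nonzero orbit never comes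
    close to 0.
    If [p = 1/2], the bounded functional [x |-> \sum_k (-1)^k x_(2k)] on l^1
    vanishes on the range of [Wbar_p] by telescoping.  Hence vectors of value 1
    stay at distance at least 1 from all [a *: Wbar_p^n x] with [0 < n]; two
    such vectors would both have to be approximated by the line spanned by
    [x]. *)

Set Implicit Arguments.
Unset Strict Implicit.
Unset Printing Implicit Defensive.

Import Order.TTheory GRing.Theory Num.Theory.
Import Normc.

Local Open Scope ring_scope.

(** * Modulus estimates in [R[i]] *)

Lemma normc_real (R : realType) (r : R) : 0 <= r -> normc r%:C%C = r.
Proof. by move=> r0; rewrite /= expr0n addr0 sqrtr_sqr ger0_norm. Qed.

Lemma normc_sum (R : realType) n (F : 'I_n -> R[i]) :
  normc (\sum_(k < n) F k) <= \sum_(k < n) normc (F k).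
Proof.
elim/big_ind2: _ => [|u r v t le1 le2|//]; first by rewrite normc0.
exact: le_trans (normcD_le _ _) (lerD le1 le2).
Qed.

Lemma normc_sign (R : realType) n : normc ((-1) ^+ n : R[i]) = 1.
Proof. by elim: n => [|n IH]; rewrite ?normc1 // exprS mulN1r normcN. Qed.

Lemma normc_sub (R : realType) (u v : R[i]) : normc u <= normc (u - v) + normc v.
Proof. by rewrite -{1}[u](subrK v); exact: normcD_le. Qed.

(** * Density and norm-nondecreasing operators *)

Lemma dense_approx (K : numFieldType) (X : normedModType K) (S : set X) :
  dense S -> forall (v : X) (e : K), 0 < e -> exists2 y, S y & `|v - y| < e.
Proof.
move=> dS v e e0; have [|y [vy Sy]] := dS (ball v e) _ (ball_open v e).
  by exists v; exact: ballxx.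
by exists y => //; move: vy; rewrite -ball_normE.
Qed.

(** The orbit of a nonzero [x] avoids the open ball of radius [|x|] around 0, and the orbit of 0
    stays at 0. The vector [v] excludes the zero space, where the orbit of 0 is dense. *)
Lemma nondecreasing_norm_not_hypercyclic (K : numFieldType)
    (X : normedModType K) (T : bounded_operator X) (v : X) :
  v != 0 -> (forall x, `|x| <= `|T x|) -> ~ hypercyclic T.
Proof.
move=> v0 Tge [x dx].
have iterge n : `|x| <= `|iter n T x|.
  by elim: n => //= n IH; exact: le_trans IH (Tge _).
have [x0|x0] := eqVneq x 0.
  have iter0 n : iter n T x = 0 by elim: n => //= n ->; rewrite linear0.
  have [|_ [n _ <-]] := dense_approx dx v (e := `|v|); first by rewrite normr_gt0.
  by rewrite iter0 subr0 ltxx.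
have [|_ [n _ <-]] := dense_approx dx 0 (e := `|x|); first by rewrite normr_gt0.
by rewrite sub0r normrN => /lt_le_trans/(_ (iterge n)); rewrite ltxx.
Qed.

(** * Lower bound for [Wbar p] in a shift-invariant norm *)

Section ShiftInvariantNorm.
Variables (R : realType) (P : set (int -> R[i]^o)) (N : (int -> R[i]^o) -> R).
Hypothesis H : shift_invariant_norm P N.
Variable p : R.
Hypothesis hp : 0 < p < 1.

Lemma Wbar_norm_ge x : P x ->
  `|1 - 2 * p| * N x <= N (matrix_action (Wbar p) x).
Proof.
move=> Px; have [p0 p1] := andP hp.
have Q0 : 0 <= 1 - p by lra.
have Ps k := sin_Pshift H k Px.
have P1 := sin_PZ H (1 - p)%:C%C (Ps (- 1)).
have P2 := sin_PZ H p%:C%C (Ps 1).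
have := sin_NZ H (1 - p)%:C%C (Ps (- 1)); have := sin_NZ H p%:C%C (Ps 1).
rewrite !(sin_Nshift H _ Px) (normc_real (ltW p0)) (normc_real Q0) => N2 N1.
(* Reverse triangle inequality. It is applied in both orders to the two shifted terms, of norms
   [(1 - p) * N x] and [p * N x], to cover either sign of [1 - 2 * p]. *)
have NB y z : P y -> P z -> N y - N z <= N (y + z).
  move=> Py Pz; have := sin_ND H (sin_PD H Py Pz) (sin_PZ H (- 1) Pz).
  rewrite (sin_NZ H _ Pz) normcN normc1 mul1r.
  rewrite scaleN1r addrK; lra.
rewrite Wbar_actionE.
have := NB _ _ P2 P1; rewrite [X in _ <= N X]addrC.
have := NB _ _ P1 P2; rewrite N1 N2.
by case: ger0P => _ le1 le2; [apply: le_trans le1|apply: le_trans le2]; lra.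
Qed.

Lemma scale_Wbar_not_hypercyclic (v : seq_space H) (lambda : R[i]) :
  v != 0 -> p != 1 / 2 -> 1 / `|1 - 2 * p| <= normc lambda ->
  ~ hypercyclic (scale_operator lambda (Wbar_operator H p)).
Proof.
move=> v0 p2 hl; apply: (nondecreasing_norm_not_hypercyclic v0) => x.
have d0 : 0 < `|1 - 2 * p|.
  by rewrite normr_gt0; apply: contra p2 => /eqP h; apply/eqP; lra.
have Nx0 : 0 <= N x by have := normr_ge0 x; rewrite seq_space_normE ler0c.
rewrite /= normrZ !seq_space_normE normcE0 -rmorphM lecR /=.
apply: le_trans (ler_wpM2l (normc_ge0 _) (Wbar_norm_ge (seq_mem x))).
rewrite mulrA ler_peMl //.
by move: hl; rewrite ler_pdivrMr.
Qed.

End ShiftInvariantNorm.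

(** * The unit vector at 0 and summation in l^1 *)

Section SummableSequences.
Variable R : realType.
Notation l1 := (lq (R := R) 1).
Notation norm1 := (lq_norm (R := R) 1).
Implicit Types x y z : int -> R[i]^o.

(** Serves both as a nonzero vector of every space considered and as a vector on which the
    alternating functional equals 1. *)
Definition indicator0 : int -> R[i]^o := fun i => if i == 0 then 1 else 0.

Lemma indicator0_c0 : c0 indicator0.
Proof.
move=> e e0; exists 1%N => i i1; rewrite /indicator0 ifF ?normc0 //.
by apply/eqP => i0; rewrite i0 in i1.
Qed.

Lemma indicator0_lq (q : R) : 1 <= q -> lq q indicator0.
Proof.
move=> q1; have q0 : q != 0 by apply/eqP => q0; lra.
rewrite /lq /= /lq_sum.
rewrite (_ : esum _ _ =
    \esum_(i in [set (0 : int)]) (1%E : \bar R)); last first.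
  rewrite [RHS]esum_mkcond; apply: eq_esum => i _.
  rewrite /indicator0; have [->|i0] := eqVneq i 0.
    by rewrite mem_set // normc1 powR1.
  by rewrite normc0 powR0 // memNset //=; apply/eqP.
by rewrite esum_set1 ?ltry.
Qed.

Lemma seq_sum_le_norm1 x (s : seq int) : l1 x -> uniq s ->
  \sum_(i <- s) normc (x i) <= norm1 x.
Proof.
move=> lx us; rewrite -lee_fin -[norm1 x]powRr1 ?lq_norm_ge0 // -lq_sumE //.
apply: esum_ge; exists [set` s]%classic; first by split; first exact: finite_seq.
rewrite -sumEFin -fsbig_seq //.
by apply: lee_sum => i _; rewrite powRr1 ?normc_ge0.
Qed.

Lemma progression_sum_le_norm1 x (a b : int) n : l1 x -> b != 0 ->
  \sum_(k < n) normc (x (a + b * k%:Z)) <= norm1 x.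
Proof.
move=> lx b0.
rewrite -(big_mkord xpredT (fun k => normc (x (a + b * k%:Z)))) /index_iota subn0.
rewrite -(big_map (fun k : nat => a + b * k%:Z) xpredT (fun i => normc (x i))).
apply: seq_sum_le_norm1 => //; rewrite map_inj_uniq ?iota_uniq //.
by move=> j k /addrI/(mulfI b0)[].
Qed.

(** Otherwise the first [n] such pairs would sum to at least [e * n], yet both progressions have
    sums bounded by the norm. These pairs are the end terms left by telescoping over the even
    positions from [-2n] to [2n]. *)
Lemma l1_small_ends x (e : R) : l1 x -> 0 < e ->
  exists n : nat, normc (x (- 1 - 2 * n%:Z)) + normc (x (1 + 2 * n%:Z)) < e.
Proof.
move=> lx e0; apply: contrapT => big.
have ge n : e <= normc (x (- 1 - 2 * n%:Z)) + normc (x (1 + 2 * n%:Z)).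
  by rewrite leNgt; apply/negP => lt; apply: big; exists n.
have le n : e * n%:R <= 2 * norm1 x.
  have -> : e * n%:R = \sum_(k < n) e by rewrite sumr_const card_ord mulr_natr.
  apply: (@le_trans _ _ (\sum_(k < n) normc (x (- 1 + (- 2) * k%:Z)) +
      \sum_(k < n) normc (x (1 + 2 * k%:Z)))).
    by rewrite -big_split; apply: ler_sum => k _; rewrite mulNr; exact: ge.
  by rewrite mulrDl mul1r; apply: lerD; exact: progression_sum_le_norm1.
have := le (Num.bound (2 * norm1 x / e)).
rewrite mulrC -ler_pdivlMr // leNgt archi_boundP //.
by rewrite divr_ge0 ?mulr_ge0 ?lq_norm_ge0 ?ltW.
Qed.

(** Each entry is half the sum of its two neighbours, so consecutive terms share a neighbour with
    opposite signs and the sum telescopes. *)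
Lemma alternating_sum_Wbar_half x (a : int) n :
  \sum_(k < n) (-1) ^+ k * matrix_action (Wbar (1 / 2)) x (a + 2 * k%:Z) =
  (1 / 2)%:C%C * (x (a - 1) - (-1) ^+ n * x (a - 1 + 2 * n%:Z)).
Proof.
elim: n => [|n IH]; first by rewrite big_ord0 expr0 mulr0 addr0; ring.
rewrite big_ord_recr /= {}IH Wbar_actionE.
rewrite (_ : 1 - 1 / 2 = 1 / 2 :> R); last by lra.
rewrite /Defs.shift !fctE /= /GRing.scale /=.
rewrite (_ : a + 2 * n%:Z + -1 = a - 1 + 2 * n%:Z); last by lia.
rewrite (_ : a + 2 * n%:Z + 1 = a - 1 + 2 * n.+1%:Z); last by lia.
rewrite exprS; ring.
Qed.

(** The alternating functional is truncated to a finite symmetric window: [y] contributes a sign,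
    and the range vector only two end terms, which a large window makes negligible. *)
Lemma Wbar_half_range_dist x y (w : R[i]) : l1 x ->
  (forall k : int, y (2 * k) = indicator0 (2 * k)) ->
  l1 (y - w *: matrix_action (Wbar (1 / 2)) x) ->
  1 <= norm1 (y - w *: matrix_action (Wbar (1 / 2)) x).
Proof.
move=> lx yE; set z := (X in l1 X) => lz; apply/ler_addgt0Pr => e e0.
have w0 := normc_ge0 w; have w1 : 0 < normc w + 1 by lra.
(* Dividing by [normc w + 1] keeps the threshold defined when [w = 0] and gives
   [normc tail <= e]. *)
have [n small] := l1_small_ends lx (divr_gt0 e0 w1).
pose a : int := - 2 * n%:Z.
pose tail : R[i] := w * ((1 / 2)%:C%C * (x (- 1 - 2 * n%:Z) + x (1 + 2 * n%:Z))).
(* Position 0 is reached at [k = n], whence the sign. *)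
have sum_y : \sum_(k < (2 * n).+1) (-1) ^+ k * y (a + 2 * k%:Z) = (-1) ^+ n.
  have n_lt : (n < (2 * n).+1)%N by lia.
  rewrite (bigD1 (Ordinal n_lt)) //= big1 => [|k kn].
    rewrite (_ : a + 2 * n%:Z = 2 * 0); last by rewrite /a; lia.
    by rewrite yE /indicator0 mulr0 eqxx mulr1 addr0.
  rewrite (_ : a + 2 * k%:Z = 2 * (k%:Z - n%:Z)); last by rewrite /a; lia.
  rewrite yE /indicator0 ifF ?mulr0 //; apply/eqP => kn0.
  by case/eqP: kn; apply: val_inj => /=; lia.
have sum_z : \sum_(k < (2 * n).+1) (-1) ^+ k * z (a + 2 * k%:Z) =
    (-1) ^+ n - tail.
  rewrite -sum_y (_ : tail = w * \sum_(k < (2 * n).+1)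
      (-1) ^+ k * matrix_action (Wbar (1 / 2)) x (a + 2 * k%:Z)).
    rewrite mulr_sumr -sumrB; apply: eq_bigr => k _.
    by rewrite [z _](_ : _ = y (a + 2 * k%:Z) -
      w * matrix_action (Wbar (1 / 2)) x (a + 2 * k%:Z)) //; ring.
  rewrite alternating_sum_Wbar_half /tail exprS exprM sqrrN expr1n expr1n.
  rewrite (_ : a - 1 = - 1 - 2 * n%:Z); last by rewrite /a; lia.
  rewrite (_ : - 1 - 2 * n%:Z + 2 * (2 * n).+1%:Z = 1 + 2 * n%:Z); last by lia.
  ring.
have le_z : normc ((-1) ^+ n - tail) <= norm1 z.
  rewrite -sum_z; apply: le_trans (normc_sum _) _.
  under eq_bigr do rewrite normcM normc_sign mul1r.
  exact: progression_sum_le_norm1.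
have le_tail : normc tail <= e.
  rewrite !normcM normc_real ?divr_ge0 //.
  have := normcD_le (x (- 1 - 2 * n%:Z)) (x (1 + 2 * n%:Z)).
  move: small; rewrite ltr_pdivlMr //.
  have := normc_ge0 (x (- 1 - 2 * n%:Z) + x (1 + 2 * n%:Z)).
  set s := normc (_ + _); set t := normc _ + normc _ => s0 te st; nra.
have := normc_sub ((-1) ^+ n) tail; rewrite normc_sign => /le_trans; apply.
by rewrite lerD.
Qed.

(** * Failure of supercyclicity on l^1 for [p = 1/2] *)

Notation q1 := (lexx (1 : R)).

(** An approximant with [n > 0] lies in the range, hence at distance at least 1 from [v]; only
    multiples of [x] itself remain. *)
Lemma Wbar_half_projective_orbit_near (x v : lqZ q1) :
  dense [set a *: iter n (Wbar_lq q1 (1 / 2)) x |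
           a in [set: R[i]] & n in [set: nat]] ->
  (forall k : int, v (2 * k) = indicator0 (2 * k)) ->
  exists a : R[i], forall i, normc (v i - a * x i) < 1 / 4.
Proof.
move=> dx vE.
have e0 : 0 < ((1 / 4 : R)%:C%C : R[i]) by rewrite (ltcR 0); lra.
have [_ [a _ [n _ <-]]] := dense_approx dx v e0.
rewrite seq_space_normE ltcR => near_v.
have lin : l1 (v - a *: iter n (Wbar_lq q1 (1 / 2)) x) by exact: seq_mem.
case: n near_v lin => [|n] near_v lin.
  by exists a => i; apply: le_lt_trans near_v; exact: (lq_ptwise q1 i lin).
have := Wbar_half_range_dist (seq_mem (iter n (Wbar_lq q1 (1 / 2)) x)) vE lin.
by move=> /le_lt_trans/(_ near_v); lra.
Qed.

Lemma Wbar_half_not_supercyclic : ~ supercyclic (Wbar_lq q1 (1 / 2)).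
Proof.
move=> [x dx].
have l0 := indicator0_lq q1.
pose v0 : lqZ q1 :=
  SeqSpace (mem_set l0 : _ \in seq_pred (lq_shift_invariant_norm q1)).
have l01 := sin_PD (lq_shift_invariant_norm q1) l0
  (sin_Pshift (lq_shift_invariant_norm q1) (- 1) l0).
(* The sum of the unit vectors at 0 and 1: it agrees with [v0] at even positions but is not
   collinear with it. *)
pose v1 : lqZ q1 :=
  SeqSpace (mem_set l01 : _ \in seq_pred (lq_shift_invariant_norm q1)).
have [//|a near0] := Wbar_half_projective_orbit_near (v := v0) dx.
have [|b near1] := Wbar_half_projective_orbit_near (v := v1) dx.
  move=> k; rewrite /= !fctE /Defs.shift /indicator0.
  by rewrite (_ : (2 * k + -1 == 0) = false) ?addr0 //; apply/eqP; lia.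
have /= := near0 0; have /= := near0 1; have /= := near1 0; have /= := near1 1.
rewrite !fctE /Defs.shift /indicator0 /= add0r addr0 sub0r normcN.
move=> d c b1 a1.
have Aa := normc_sub 1 (a * x 0); have Dd := normc_sub 1 (b * x 1).
have := normc_sub (b * x 0) 1; rewrite -(normcN (b * x 0 - 1)) opprB normc1 => Cc.
rewrite normc1 in Aa Dd.
(* The 2 by 2 determinant of two multiples of [x] vanishes. The left side exceeds (3/4)^2 = 9/16,
   while the right side is at most (1/4)(5/4) = 5/16. *)
have : normc (a * x 0) * normc (b * x 1) = normc (a * x 1) * normc (b * x 0).
  by rewrite -!normcM; congr normc; ring.
have := normc_ge0 (a * x 1); nra.
Qed.

End SummableSequences.

Theorem proposition4p7 (R : realType) (p : R) (hp : 0 < p < 1) :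
  (p != 1 / 2 ->
    (forall lambda : R[i], 1 / `|1 - 2 * p| <= normc lambda ->
      ~ hypercyclic (scale_operator lambda (Wbar_c0 p))) /\
    (forall (q : R) (q1 : 1 <= q) (lambda : R[i]),
      1 / `|1 - 2 * p| <= normc lambda ->
      ~ hypercyclic (scale_operator lambda (Wbar_lq q1 p)))) /\
  (p = 1 / 2 -> ~ supercyclic (Wbar_lq (lexx (1 : R)) p)).
Proof.
have indicator0_neq0 P N (H : shift_invariant_norm P N) (P0 : P (@indicator0 R)) :
    SeqSpace (mem_set P0 : _ \in seq_pred H) != 0.
  apply/eqP => /(congr1 (fun u : seq_space H => u 0)) /=.
  by rewrite /indicator0 eqxx => /eqP; rewrite oner_eq0.
split=> [p2|->]; last exact: Wbar_half_not_supercyclic.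
split=> [lambda|q q1 lambda].
  exact: (scale_Wbar_not_hypercyclic hp (indicator0_neq0 _ _ _ (@indicator0_c0 R))).
exact: (scale_Wbar_not_hypercyclic hp (indicator0_neq0 _ _ _ (indicator0_lq q1))).
Qed.
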